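(* Let $n\ge 1$, $p\in(0,1)$, $\gamma>0$, and let $\mathcal{B}_{\ell_p}=\{\bm{x}\in\mathbb{R}^n : \sum_{i=1}^n |x_i|^p\le\gamma\}$. Let $f:\mathbb{R}^n\to\mathbb{R}$ be twice continuously differentiable (possibly nonconvex) with Lipschitz continuous gradient on $\mathcal{B}_{\ell_p}$, and let $\bm{x}^k\in\mathcal{B}_{\ell_p}$. Suppose $\nabla f(\bm{x}^k)\neq\bm{0}$. Let $\mathcal{I}^k_{\max}:=\operatorname{arg\,max}_{i\in\{1,\dots,n\}}|\nabla_i f(\bm{x}^k)|$. Then a global optimal solution $\bm{s}^k$ of the problem $$\min_{\bm{s}\in\mathbb{R}^n}\ \langle\nabla f(\bm{x}^k),\bm{s}\rangle\quad\text{subject to}\quad \bm{s}\in\mathcal{B}_{\ell_p}$$ is given by $$s_i^k=\begin{cases}-\operatorname{sgn}(\nabla_i f(\bm{x}^k))\,\gamma^{1/p}, & \text{if } i\in\mathcal{I}^k_{\max},\\ 0, & \text{otherwise.}\end{cases}$$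
   Context: $\nabla_i f$ denotes the $i$-th component of $\nabla f$, and $\langle\cdot,\cdot\rangle$ is the standard inner product on $\mathbb{R}^n$. The sign function is $\operatorname{sgn}(t)=1$ if $t>0$, $0$ if $t=0$, $-1$ if $t<0$. The point $\bm{x}^k$ is the current (feasible) iterate of an algorithm for minimizing $f$ over the nonconvex set $\mathcal{B}_{\ell_p}$, and the displayed problem is its Frank-Wolfe subproblem.
   Formalization: With ties in the arg max the displayed point has constraint value |I_max|·γ > γ and is infeasible (e.g. f = x_1 + x_2), so I_max is replaced by an arbitrary one-element subset of the arg max set; if the maximizer is unique the statement is unchanged. *)

(* Defs.v *)
From HB Require Import structures.
From mathcomp Require Import all_boot all_order all_algebra.
From mathcomp Require Import all_classical all_reals all_analysis.

Set Implicit Arguments.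
Unset Strict Implicit.
Unset Printing Implicit Defensive.

Import Order.TTheory GRing.Theory Num.Theory.
Import numFieldNormedType.Exports.

Local Open Scope ring_scope.

Definition dot (R : realType) (n : nat) (u v : 'rV[R]_n) : R :=
  \sum_(i < n) u 0 i * v 0 i.

(* The library norm `|u| on 'rV[R]_n is the sup norm, not this one. *)
Definition enorm (R : realType) (n : nat) (u : 'rV[R]_n) : R :=
  Num.sqrt (dot u u).

(* For 0 < p, powR 0 p = 0, so zero coordinates contribute nothing. *)
Definition lp_ball (R : realType) (n : nat) (p gamma : R) : set 'rV[R]_n :=
  [set x : 'rV[R]_n | \sum_(i < n) `|x 0 i| `^ p <= gamma]%classic.

Definition gradient (R : realType) (n : nat) (f : 'rV[R]_n -> R)
    (x : 'rV[R]_n) : 'rV[R]_n :=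
  \row_(i < n) 'D_(delta_mx 0 i) f x.

(* The Jacobian of the gradient is the Hessian of f. *)
Definition twice_continuously_differentiable (R : realType) (n : nat)
    (f : 'rV[R]_n -> R) : Prop :=
  [/\ forall x, differentiable f x,
      forall x, differentiable (gradient f) x
    & continuous (fun x => 'J (gradient f) x)].

Definition lipschitz_on_set (R : realType) (n : nat) (A : set 'rV[R]_n)
    (F : 'rV[R]_n -> 'rV[R]_n) : Prop :=
  exists L : R, forall x y, A x -> A y ->
    enorm (F x - F y) <= L * enorm (x - y).

(* The set of all maximizers. A vector with entries of modulus
   gamma `^ p^-1 on a set I has \sum_i `|s i| `^ p = #|I| * gamma, so it lies in
   lp_ball p gamma only if #|I| <= 1: the optimality statement is about an
   arbitrary one-element subset of argmax_abs g, that is, any tie-breaking. *)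
Definition argmax_abs (R : realType) (n : nat) (g : 'rV[R]_n) : {set 'I_n} :=
  [set i : 'I_n | [forall j : 'I_n, `|g 0 j| <= `|g 0 i|]]%SET.

Definition global_minimizer (R : realType) (T : Type) (A : set T)
    (h : T -> R) (s : T) : Prop :=
  A s /\ forall t, A t -> h s <= h t.

(* Main.v *)
(** On the ball every entry satisfies |t_i| <= c with c = gamma^(1/p), so
    |t_i| = |t_i|^p |t_i|^(1-p) <= |t_i|^p c^(1-p); summing over i shows that
    the l_p ball lies in the l_1 ball of radius c. By Hoelder's inequality,
    <g, t> >= - c max_i |g_i|, and the proposed one-sparse vector attains this
    bound. *)
Require Import Defs.
From HB Require Import structures.
From mathcomp Require Import all_boot all_order all_algebra.
From mathcomp Require Import all_classical all_reals all_analysis.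
Import Order.TTheory GRing.Theory Num.Theory.
Import numFieldNormedType.Exports.
Local Open Scope ring_scope.

Lemma sum_norm_le_lp_ball (R : realType) (n : nat) (p gamma : R)
    (t : 'rV[R]_n) :
  0 < p <= 1 -> 0 <= gamma -> lp_ball p gamma t ->
  \sum_(i < n) `|t 0 i| <= gamma `^ p^-1.
Proof.
move=> /andP[p0 p1] gamma0; rewrite /lp_ball /= => ht.
have powVK (x : R) : 0 <= x -> (x `^ p) `^ p^-1 = x.
  by move=> x0; rewrite -powRrM mulfV ?gt_eqF// powRr1.
have entry_le i : `|t 0 i| <= gamma `^ p^-1.
  rewrite -[leLHS]powVK//.
  apply: ge0_ler_powR; rewrite ?nnegrE ?powR_ge0 ?invr_ge0 ?(ltW p0)//.
  apply: le_trans ht; rewrite (bigD1 i)//= lerDl.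
  by apply: sumr_ge0 => j _; exact: powR_ge0.
(* The identity includes x = 0: the exponents add up to 1, which is nonzero, so [powRD] applies
   there too. *)
have split_pow (x : R) : 0 <= x -> x = x `^ p * x `^ (1 - p).
  move=> x0; rewrite -powRD ?subrKC ?powRr1//.
  by rewrite oner_eq0.
(* With c = gamma^(1/p), the bound c is written as c^p c^(1-p) = gamma c^(1-p), so that [ht] scaled
   by c^(1-p) leaves a termwise comparison. *)
rewrite [leRHS]split_pow ?powR_ge0// -powRrM mulVf ?gt_eqF// powRr1//.
apply: le_trans (ler_wpM2r (powR_ge0 _ _) ht).
rewrite mulr_suml; apply: ler_sum => i _.
rewrite {1}[`|t 0 i|]split_pow//; apply: ler_wpM2l; first exact: powR_ge0.
by apply: ge0_ler_powR; rewrite ?nnegrE ?powR_ge0 ?subr_ge0.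
Qed.

(** Termwise, -g_j t_j <= |g_j| |t_j| <= |g_i| |t_j|, the last step by maximality of |g_i|. *)
Lemma dot_ge_argmax_abs (R : realType) (n : nat) (g t : 'rV[R]_n) (i : 'I_n) :
  i \in argmax_abs g -> - (`|g 0 i| * \sum_(j < n) `|t 0 j|) <= dot g t.
Proof.
rewrite inE => /forallP gmax; rewrite lerNl /dot -sumrN mulr_sumr.
apply: ler_sum => j _; apply: le_trans (ler_norm _) _.
by rewrite normrN normrM ler_wpM2r.
Qed.

Theorem theorem2p1 (R : realType) (n : nat) (p gamma : R)
    (f : 'rV[R]_n -> R) (xk : 'rV[R]_n) (Imax : {set 'I_n})
    (hn : (1 <= n)%N) (hp : 0 < p < 1) (hgamma : 0 < gamma)
    (hf : twice_continuously_differentiable f)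
    (hlip : lipschitz_on_set (lp_ball p gamma) (gradient f))
    (hxk : lp_ball p gamma xk)
    (hgrad : gradient f xk <> 0)
    (hImax : Imax \subset argmax_abs (gradient f xk))
    (hImax1 : #|Imax| = 1%N) :
  global_minimizer (lp_ball p gamma) (fun s => dot (gradient f xk) s)
    (\row_(i < n) (if i \in Imax
                   then - Num.sg (gradient f xk 0 i) * gamma `^ p^-1
                   else 0)).
Proof.
have /andP[p0 p1] := hp.
have /eqP/cards1P[i Imax_i] := hImax1.
have i_max : i \in argmax_abs (gradient f xk).
  by apply: (fintype.subsetP hImax); rewrite Imax_i inE.
move: (gradient f xk) i_max => g i_max; split.
  rewrite /lp_ball /= (bigD1 i)//= big1 ?addr0 => [|j ji].
    rewrite mxE Imax_i inE eqxx normrM normrN.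
    rewrite (ger0_norm (powR_ge0 _ _)) powRM ?powR_ge0//.
    rewrite -powRrM mulVf ?gt_eqF// powRr1 ?(ltW hgamma)//.
    (* The sum has collapsed to |sgn(g_i)|^p gamma, whose first factor is 0 or 1. *)
    apply: ler_piMl (ltW hgamma) _.
    rewrite normr_sg; case: (g 0 i != 0); first by rewrite powR1.
    by rewrite powR0 ?gt_eqF.
  by rewrite mxE Imax_i inE (negbTE ji) normr0 powR0 ?gt_eqF.
move=> t ht; apply: le_trans (dot_ge_argmax_abs _ _ _ _ _ i_max).
rewrite {1}/dot (bigD1 i)//= big1 ?addr0 => [|j ji]; last first.
  by rewrite mxE Imax_i inE (negbTE ji) mulr0.
(* The candidate has value -|g_i| c with c = gamma^(1/p), so what remains is the l_1 bound on t
   scaled by |g_i|. *)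
rewrite mxE Imax_i inE eqxx mulNr mulrN lerN2 mulrA.
rewrite [_ * Num.sg _]mulrC -normrEsg.
by apply: ler_wpM2l => //; apply: sum_norm_le_lp_ball => //; rewrite ?p0 ltW.
Qed.
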